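(* Let $A\in\mathbb{R}^{M\times N}$ with $M<N$ have nonzero columns and let $d\in\mathbb{R}^M$. Given an arbitrary $\omega\in\Omega_{\max}$, let $\hat u$ solve $(\mathcal P_\omega)$. Then: (i) $\hat u=Z_\omega(\hat u_\omega)$, where $\hat u_\omega=\left(A_\omega^TA_\omega\right)^{-1}A_\omega^Td$, and $\hat\sigma=\sigma(\hat u)$ obeys $\hat\sigma\subseteq\omega$ and $\hat\sigma\in\Omega_{\max}$; (ii) for any $\beta>0$, $\hat u$ is a strict (local) minimizer of $F_d(u)=\|Au-d\|_2^2+\beta\|u\|_0$; (iii) $\hat u$ solves $(\mathcal P_{\hat\sigma})$.
   Context: $\mathbb{I}_N=\{1,\dots,N\}$. For $u\in\mathbb{R}^N$, $\sigma(u)=\{i\in\mathbb{I}_N: u[i]\ne0\}$ and $\|u\|_0=\#\sigma(u)$. For $\omega\subseteq\mathbb{I}_N$, problem $(\mathcal P_\omega)$ is: minimize $\|Au-d\|_2^2$ over $u\in\mathbb{R}^N$ subject to $u[i]=0$ for all $i\in\mathbb{I}_N\setminus\omega$. A point $\hat u$ is a strict (local) minimizer of $F_d$ if there is a neighborhood $O$ of $\hat u$ with $F_d(\hat u)<F_d(v)$ for all $v\in O\setminus\{\hat u\}$. For $\omega\subseteq\mathbb{I}_N$ (listed in increasing order), $A_\omega\in\mathbb{R}^{M\times\#\omega}$ is the submatrix of $A$ formed by the columns indexed by $\omega$, $A_\omega^T=(A_\omega)^T$, $u_\omega$ is the corresponding subvector of $u$, and $Z_\omega:\mathbb{R}^{\#\omega}\to\mathbb{R}^N$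 is zero padding: $Z_\omega(w)[\omega[k]]=w[k]$ and $Z_\omega(w)[i]=0$ for $i\notin\omega$. Conventions: $A_\varnothing\in\mathbb{R}^{M\times0}$, $\operatorname{rank}(A_\varnothing)=0$, and $Z_\varnothing$ gives $0\in\mathbb{R}^N$. For $r\in\{1,\dots,M\}$, $\Omega_r=\{\omega\subset\mathbb{I}_N:\#\omega=r=\operatorname{rank}(A_\omega)\}$; $\Omega_0=\{\varnothing\}$; $\Omega_{\max}=\bigcup_{r=0}^{M}\Omega_r$. *)

(* Defs.v *)
From mathcomp Require Import all_boot all_order all_algebra.
From mathcomp Require Import classical_sets reals topology normedtype.

Set Implicit Arguments.
Unset Strict Implicit.
Unset Printing Implicit Defensive.

Import Order.TTheory GRing.Theory Num.Theory.
Import numFieldNormedType.Exports.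

Local Open Scope ring_scope.

(* The library norm on matrices is the sup norm, hence this definition. *)
Definition sqnorm2 (R : realType) (n : nat) (v : 'cV[R]_n) : R :=
  \sum_i v i 0 ^+ 2.

Definition supp (R : realType) (N : nat) (u : 'cV[R]_N) : {set 'I_N} :=
  [set i | u i 0 != 0].

Definition norm0 (R : realType) (N : nat) (u : 'cV[R]_N) : nat := #|supp u|.

(* [enum_val : 'I_#|w| -> 'I_N] lists the elements of [w] in increasing
   order, i.e. it is the map k |-> w[k]. *)
Definition subcols (R : realType) (M N : nat) (A : 'M[R]_(M, N))
    (w : {set 'I_N}) : 'M[R]_(M, #|w|) :=
  colsub (fun k : 'I_#|w| => enum_val k) A.

Definition subvec (R : realType) (N : nat) (w : {set 'I_N}) (u : 'cV[R]_N) :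
    'cV[R]_#|w| :=
  rowsub (fun k : 'I_#|w| => enum_val k) u.

Definition zeropad (R : realType) (N : nat) (w : {set 'I_N})
    (x : 'cV[R]_#|w|) : 'cV[R]_N :=
  \col_i (if [pick k : 'I_#|w| | enum_val k == i] is Some k then x k 0 else 0).

Definition Omega (R : realType) (M N : nat) (A : 'M[R]_(M, N)) (r : nat) :
    {set {set 'I_N}} :=
  if r == 0%N then [set finset.set0]
  else [set w : {set 'I_N} | (#|w| == r) && (r == \rank (subcols A w))].

Definition Omega_max (R : realType) (M N : nat) (A : 'M[R]_(M, N)) :
    {set {set 'I_N}} :=
  (\bigcup_(r < M.+1) Omega A r)%SET.

Definition feasible (R : realType) (N : nat) (w : {set 'I_N}) (u : 'cV[R]_N) :
    Prop :=
  forall i, i \notin w -> u i 0 = 0.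

Definition solves_P (R : realType) (M N : nat) (A : 'M[R]_(M, N))
    (d : 'cV[R]_M) (w : {set 'I_N}) (u : 'cV[R]_N) : Prop :=
  feasible w u /\
  forall v : 'cV[R]_N, feasible w v ->
    sqnorm2 (A *m u - d) <= sqnorm2 (A *m v - d).

Definition objF (R : realType) (M N : nat) (A : 'M[R]_(M, N)) (d : 'cV[R]_M)
    (beta : R) (u : 'cV[R]_N) : R :=
  sqnorm2 (A *m u - d) + beta * (norm0 u)%:R.

(* [nbhs] is the product topology on the entries, i.e. the usual topology. *)
Definition strict_local_minimizer (R : realType) (N : nat)
    (F : 'cV[R]_N -> R) (u : 'cV[R]_N) : Prop :=
  exists2 O : set 'cV[R]_N, nbhs u O & forall v, O v -> v <> u -> F u < F v.

(* Main.v *)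
Require Import Defs.
From mathcomp Require Import all_boot all_order all_algebra.
From mathcomp Require Import classical_sets reals topology normedtype.
From mathcomp Require Import ring lra.

Set Implicit Arguments.
Unset Strict Implicit.
Unset Printing Implicit Defensive.

Local Open Scope ring_scope.

(** Write A_w for the columns of A in w.  A set w lies in Omega_max exactly
    when A is injective on the vectors supported in w; this property passes to
    subsets of w, which gives the claim on the support s of u.  Minimality
    along lines gives the normal equations, so the residual A u - d is
    orthogonal to A h for every h supported in w.  If v = u + h is close to
    u, then s is contained in the support of v.  Either h is supported in s,
    and then Pythagoras gives the strict increase |A h|^2 > 0 of the quadratic
    term, or v has at least one more nonzero entry than u, and then the
    penalty gains beta, which by continuity exceeds the loss in the quadratic
    term. *)

Import Order.TTheory GRing.Theory Num.Theory.
Import numFieldNormedType.Exports.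

Section Padding.
Variables (R : realType) (M N : nat).
Implicit Types (A : 'M[R]_(M, N)) (w s : {set 'I_N}) (u h v : 'cV[R]_N).

Lemma feasibleP w u : reflect (feasible w u) (supp u \subset w).
Proof.
apply: (iffP fintype.subsetP) => [uw i iw | uw i].
  by apply/eqP; apply: contraNT iw => ui; apply: uw; rewrite inE.
by rewrite inE; apply: contraR => /uw ->.
Qed.

Lemma feasibleS s w u : s \subset w -> feasible s u -> feasible w u.
Proof. by move=> sw /feasibleP su; apply/feasibleP; exact: fintype.subset_trans su sw. Qed.

Lemma feasibleD w u v : feasible w u -> feasible w v -> feasible w (u + v).
Proof. by move=> uw vw i iw; rewrite mxE uw // vw // addr0. Qed.

Lemma feasibleZ w (t : R) u : feasible w u -> feasible w (t *: u).
Proof. by move=> uw i iw; rewrite mxE uw // mulr0. Qed.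

Lemma zeropad_enum_val w (x : 'cV[R]_#|w|) (k : 'I_#|w|) :
  zeropad x (enum_val k) 0 = x k 0.
Proof.
rewrite mxE; case: pickP => [j /eqP/enum_val_inj -> // | /(_ k)].
by rewrite eqxx.
Qed.

Lemma feasible_zeropad w (x : 'cV[R]_#|w|) : feasible w (zeropad x).
Proof.
move=> i iw; rewrite mxE; case: pickP => // k /eqP ki.
by rewrite -ki enum_valP in iw.
Qed.

Lemma subvec_zeropad w (x : 'cV[R]_#|w|) : subvec w (zeropad x) = x.
Proof. by apply/colP=> k; rewrite mxE zeropad_enum_val. Qed.

Lemma zeropad_subvec w u : feasible w u -> zeropad (subvec w u) = u.
Proof.
move=> uw; apply/colP=> i; have [iw | iw] := boolP (i \in w).
  by rewrite -(enum_rankK_in iw iw) zeropad_enum_val mxE.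
by rewrite feasible_zeropad // uw.
Qed.

Lemma mulmx_feasible A w u :
  feasible w u -> A *m u = subcols A w *m subvec w u.
Proof.
move=> uw; apply/colP=> i; rewrite !mxE.
rewrite (bigID (mem w)) /= [X in _ + X]big1 ?addr0; last first.
  by move=> j jw; rewrite uw // mulr0.
by rewrite big_enum_val; apply: eq_bigr => k _; rewrite !mxE.
Qed.

(** The separate clause for r = 0 agrees with the rank condition because a matrix without columns
    has rank 0. The bound r <= M is automatic, since a rank is at most the number of rows. *)
Lemma Omega_maxE A w :
  (w \in Omega_max A) = (\rank (subcols A w) == #|w|).
Proof.
apply/bigcupP/eqP => [[r _] | rk].
  rewrite /Omega; case: eqP => _; rewrite inE.
    move=> /eqP ->; apply/eqP; rewrite eqn_leq rank_leq_col.
    by apply: leq_trans (leq0n _); rewrite cards0.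
  by case/andP=> /eqP wr /eqP <-.
have ltM : (#|w| < M.+1)%N by rewrite ltnS -rk rank_leq_row.
exists (Ordinal ltM) => //; rewrite /Omega /=.
by case: eqP => [/eqP | _]; rewrite inE ?cards_eq0 // rk !eqxx.
Qed.

(** Zero padding identifies the kernel of A_w with the vectors supported in w that A kills. Full
    column rank makes this kernel trivial; it enters as [row_free] of the transpose. *)
Lemma Omega_maxP A w :
  w \in Omega_max A <-> (forall h, feasible w h -> A *m h = 0 -> h = 0).
Proof.
rewrite Omega_maxE -mxrank_tr -/(row_free _); split=> [free h hw Ah0 | inj].
  rewrite -(zeropad_subvec hw); suff -> : subvec w h = 0.
    by apply/colP=> i; rewrite !mxE; case: pickP => // k _; rewrite mxE.
  apply: trmx_inj; apply: (row_free_inj free).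
  by rewrite -trmx_mul -mulmx_feasible // Ah0 !trmx0 mul0mx.
apply: inj_row_free => x xA0; apply: trmx_inj.
rewrite trmx0 -(subvec_zeropad x^T) (inj (zeropad x^T)).
- by apply/colP=> k; rewrite !mxE.
- exact: feasible_zeropad.
rewrite (mulmx_feasible _ (feasible_zeropad _)) subvec_zeropad.
by rewrite -[LHS]trmxK trmx_mul trmxK xA0 trmx0.
Qed.

Lemma Omega_maxS A s w : s \subset w -> w \in Omega_max A -> s \in Omega_max A.
Proof.
move=> sw /Omega_maxP inj; apply/Omega_maxP => h /(feasibleS sw).
exact: inj.
Qed.

End Padding.

Section Euclid.
Variable R : realType.

Lemma sqnorm2E n (x : 'cV[R]_n) : sqnorm2 x = (x^T *m x) 0 0.
Proof. by rewrite mxE; apply: eq_bigr => i _; rewrite mxE expr2. Qed.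

Lemma sqnorm2_ge0 n (x : 'cV[R]_n) : 0 <= sqnorm2 x.
Proof. by apply: sumr_ge0 => i _; exact: sqr_ge0. Qed.

Lemma sqnorm2_eq0 n (x : 'cV[R]_n) : (sqnorm2 x == 0) = (x == 0).
Proof.
apply/eqP/eqP => [x0 | ->]; last first.
  by apply: big1 => i _; rewrite mxE expr0n.
apply/colP=> i; rewrite mxE; apply/eqP; rewrite -sqrf_eq0; apply/eqP.
(* A vanishing sum of squares has only zero terms; [erefl true] stands for the trivial index
   predicate. *)
by move: i (erefl true); apply/psumr_eq0P => // i _; exact: sqr_ge0.
Qed.

Lemma sqnorm2D n (x y : 'cV[R]_n) (t : R) :
  sqnorm2 (x + t *: y) =
    sqnorm2 x + t * (x^T *m y) 0 0 *+ 2 + t ^+ 2 * sqnorm2 y.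
Proof.
rewrite /sqnorm2 mxE mulr_sumr -sumrMnl mulr_sumr -!big_split /=.
by apply: eq_bigr => i _; rewrite !mxE; ring.
Qed.

(** If x B^T B = 0, then |B x^T|^2 = x B^T B x^T = 0, so x B^T = 0 and freeness gives x = 0. *)
Lemma gram_unitmx m n (B : 'M[R]_(m, n)) :
  row_free B^T -> B^T *m B \in unitmx.
Proof.
move=> free; rewrite -row_free_unit; apply: inj_row_free => x xB0.
apply: (row_free_inj free); rewrite mul0mx; apply: trmx_inj.
rewrite trmx_mul trmxK trmx0; apply/eqP; rewrite -sqnorm2_eq0 sqnorm2E.
by rewrite trmx_mul !trmxK !mulmxA -(mulmxA x) xB0 mul0mx mxE.
Qed.

Lemma sqnorm2_residual_continuous m n (A : 'M[R]_(m, n)) (d : 'cV[R]_m) :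
  continuous (fun u : 'cV[R]_n => sqnorm2 (A *m u - d)).
Proof.
move=> u; have Fu : Filter (nbhs u) by exact: nbhs_filter.
apply: cvg_big => [|i _]; first exact: add_continuous.
have entry : ((A *m v - d) i 0 @[v --> u] --> (A *m u - d) i 0)%classic.
  rewrite !mxE; under eq_cvg do rewrite !mxE.
  apply: cvgB; last exact: cvg_cst.
  apply: cvg_big => [|j _]; first exact: add_continuous.
  by apply: cvgM; [exact: cvg_cst | exact: coord_continuous].
by rewrite expr2; under eq_cvg do rewrite expr2; exact: cvgM.
Qed.

End Euclid.

Section LeastSquares.
Variables (R : realType) (M N : nat) (A : 'M[R]_(M, N)) (d : 'cV[R]_M).
Variables (w : {set 'I_N}) (u : 'cV[R]_N).
Hypothesis solves_u : solves_P A d w u.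

Lemma residual_orthogonal h :
  feasible w h -> ((A *m u - d)^T *m (A *m h)) 0 0 = 0.
Proof.
case: solves_u => uw umin hw.
set c := (_ *m _) 0 0; set q := sqnorm2 (A *m h).
have q_ge0 : 0 <= q by exact: sqnorm2_ge0.
(* Any [t] with [t * (q + 1) = - c] turns the increment
   [2 * t * c + t ^ 2 * q] into [- t ^ 2 * (q + 2)]. *)
pose t := - c / (q + 1).
have ct : c = - (t * (q + 1)).
  by rewrite /t -mulrA mulVf ?mulr1 ?opprK //; apply: lt0r_neq0; lra.
have := umin _ (feasibleD uw (feasibleZ t hw)).
have -> : A *m (u + t *: h) - d = (A *m u - d) + t *: (A *m h).
  by rewrite mulmxDr -scalemxAr addrAC.
rewrite sqnorm2D -/c -/q -addrA lerDl ct => le0.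
have /eqP : t ^+ 2 = 0.
  have := sqr_ge0 t; have := mulr_ge0 (sqr_ge0 t) q_ge0; nra.
by rewrite sqrf_eq0 => /eqP ->; rewrite mul0r oppr0.
Qed.

Lemma sqnorm2_residualD h : feasible w h ->
  sqnorm2 (A *m (u + h) - d) = sqnorm2 (A *m u - d) + sqnorm2 (A *m h).
Proof.
move=> hw; rewrite mulmxDr addrAC -[A *m h in LHS]scale1r sqnorm2D.
by rewrite residual_orthogonal // mulr0 mul0rn addr0 expr1n mul1r.
Qed.

Lemma normal_equations :
  (subcols A w)^T *m subcols A w *m subvec w u = (subcols A w)^T *m d.
Proof.
case: solves_u => uw _; rewrite -mulmxA -(mulmx_feasible _ uw).
apply/eqP; rewrite -subr_eq0 -mulmxBr -sqnorm2_eq0 sqnorm2E; apply/eqP.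
(* Orthogonality is tested on the padding of g = A_w^T (A u - d) itself, where it reads |g|^2 =
   0. *)
set g := (subcols A w)^T *m _.
have gw := @feasible_zeropad R N w g.
rewrite -(residual_orthogonal gw) (mulmx_feasible _ gw) subvec_zeropad.
by rewrite mulmxA -{1}[subcols A w]trmxK -trmx_mul.
Qed.

(** Shrinking w to the support of u leaves fewer competitors and keeps u among them. *)
Lemma solves_P_supp : solves_P A d (supp u) u.
Proof.
case: solves_u => /feasibleP uw umin; split; first exact/feasibleP.
by move=> v /(feasibleS uw); exact: umin.
Qed.

Lemma strict_local_minimizer_objF (beta : R) :
  w \in Omega_max A -> 0 < beta -> strict_local_minimizer (objF A d beta) u.
Proof.
move=> /Omega_maxP inj beta_gt0; have uw := solves_u.1.
have Fu : Filter (nbhs u) by exact: nbhs_filter.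
exists [set v | supp u \subset supp v /\
          sqnorm2 (A *m u - d) - beta < sqnorm2 (A *m v - d)]%classic.
  apply: filterI; last first.
    by apply: cvgr_gt (@sqnorm2_residual_continuous _ _ _ A d u) _ _; lra.
  (* Each nonzero entry of u stays nonzero nearby; as there are finitely many indices, one
     neighborhood serves them all. *)
  have : \forall v \near u, forall i, i \in supp u -> (v : 'cV[R]_N) i 0 != 0.
    apply: (filter_forall Fu) => i; case: (boolP (i \in supp u)) => [iu | _].
      move: (iu); rewrite inE => ui.
      have := @cvgr_neq0 _ _ _ _ Fu _ (u i 0) (@coord_continuous R _ _ i 0 u) ui.
      by apply: (@filterS _ _ Fu) => v vi _.
    exact: filterE.
  by apply: (@filterS _ _ Fu) => v uv; apply/fintype.subsetP => i /uv; rewrite inE.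
move=> v [uv lt_v] v_neq; rewrite /objF /norm0.
(* If the supports coincide, the penalties cancel and injectivity of A on w makes |A (v - u)|^2
   positive. *)
have [vu | nvu] := boolP (supp v \subset supp u).
  have vw : feasible w v.
    by apply: feasibleS (feasibleP _ _ vu); exact/feasibleP.
  have hw : feasible w (v - u).
    by rewrite -scaleN1r; apply: feasibleD => //; exact: feasibleZ.
  have -> : supp v = supp u by apply/eqP; rewrite finset.eqEsubset vu.
  rewrite ltrD2r -[v](subrK u) [_ + u]addrC sqnorm2_residualD // ltrDl.
  rewrite lt0r sqnorm2_ge0 andbT sqnorm2_eq0; apply/eqP => Ah0.
  by apply: v_neq; apply/eqP; rewrite -subr_eq0; apply/eqP; exact: inj.
(* Here the penalty rises by at least beta, while the quadratic term drops by less than beta. *)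
have : (#|supp u| < #|supp v|)%N by apply: proper_card; rewrite properE uv.
by rewrite -(ler_nat R) -natr1 => card_lt; nra.
Qed.

End LeastSquares.

Theorem corollary3p3 (R : realType) (M N : nat) (A : 'M[R]_(M, N))
    (d : 'cV[R]_M) (hMN : (M < N)%N) (hA : forall j : 'I_N, col j A != 0)
    (w : {set 'I_N}) (hw : w \in Omega_max A)
    (uhat : 'cV[R]_N) (huhat : solves_P A d w uhat) :
  [/\ (* (i) *)
      [/\ uhat = zeropad (subvec w uhat),
          (subcols A w)^T *m subcols A w \in unitmx,
          subvec w uhat =
            invmx ((subcols A w)^T *m subcols A w) *m (subcols A w)^T *m d,
          supp uhat \subset w
        & supp uhat \in Omega_max A],
      (* (ii) *)
      forall beta : R, 0 < beta ->
        strict_local_minimizer (objF A d beta) uhat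
    & (* (iii) *)
      solves_P A d (supp uhat) uhat].
Proof.
have uw := huhat.1; have suw : supp uhat \subset w by exact/feasibleP.
split; [split=> // | move=> beta; exact: strict_local_minimizer_objF hw |].
- by rewrite zeropad_subvec.
(* [invmx] returns its argument on a singular matrix, so invertibility is what makes the formula for
   [subvec w uhat] involve a true inverse. *)
- by apply: gram_unitmx; rewrite /row_free mxrank_tr -Omega_maxE.
- rewrite -mulmxA -(normal_equations huhat) mulKmx //.
  by apply: gram_unitmx; rewrite /row_free mxrank_tr -Omega_maxE.
- exact: Omega_maxS suw hw.
exact: solves_P_supp huhat.
Qed.
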